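(* Let $\mathbf p_i,\mathbf p_f\in\mathbb E^3$ be two distinct points and let $(\mathbf u_i,\mathbf v_i,\mathbf w_i)$ be an orthonormal triple. Put $\Delta\mathbf u=(\mathbf p_f-\mathbf p_i)/|\mathbf p_f-\mathbf p_i|$ and $\tau=\arccos(\mathbf u_i\cdot\Delta\mathbf u)$, and assume $\tau\in(0,\pi)$. Then it is possible to define a unit vector $\mathbf u_f$, with $\mathbf u_i\times\mathbf u_f\neq\mathbf 0$, such that $$\mathbf u_i\cdot\Delta\mathbf u=\Delta\mathbf u\cdot\mathbf u_f$$ and such that there exists an RRMF5-I curve $\mathbf r$, with associated rational rotation-minimizing frame $(\mathbf f_1,\mathbf f_2,\mathbf f_3)$, satisfying $$\mathbf r(0)=\mathbf p_i,\quad \mathbf r(1)=\mathbf p_f,\qquad (\mathbf f_1(0),\mathbf f_2(0),\mathbf f_3(0))=(\mathbf u_i,\mathbf v_i,\mathbf w_i),\qquad \mathbf r'(0)=\mu^2\mathbf u_i,\quad \mathbf r'(1)=\mu^2\mathbf u_f$$ for some real $\mu>0$, if and only if $\tau<4\pi/5$.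
   Context: Let $\mathbb H$ be the quaternions, with pure vector quaternions identified with $\mathbb R^3$; $\mathcal A^*$ denotes conjugation and $\mathrm{vect}$ the vector part. Fix a unit pure vector $\mathbf i$; $B_i^2(t)=\binom 2i t^i(1-t)^{2-i}$. An RRMF5-I curve is a polynomial curve $\mathbf r:[0,1]\to\mathbb E^3$ with hodograph $\mathbf r'(t)=\mathcal A(t)\,\mathbf i\,\mathcal A^*(t)$, where $\mathcal A(t)=\mathcal A_0B_0^2(t)+\mathcal A_1B_1^2(t)+\mathcal A_2B_2^2(t)$, $\mathcal A_j\in\mathbb H$, and $\mathcal A_1\,\mathbf i\,\mathcal A_1^*=\mathrm{vect}(\mathcal A_2\,\mathbf i\,\mathcal A_0^* )$. It is known that this algebraic condition ensures that $\mathbf r$ has a rational rotation-minimizing frame. An adapted frame along $\mathbf r$ is a triple $(\mathbf f_1,\mathbf f_2,\mathbf f_3)$ of mutually orthogonal unit vectors depending on $t$, with $\mathbf f_1=\mathbf r'/|\mathbf r'|$; it is rotation-minimizing if it does not rotate in the normal plane about $\mathbf f_1$ (i.e. $\mathbf f_2'$ and $\mathbf f_3'$ are parallel to $\mathbf f_1$), and rational if its components are rational functions of $t$. A rotation-minimizing frame is determined up to a constant rotation in the normal plane. *)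

(* Defs.v *)
From mathcomp Require Import all_boot all_order all_algebra.
From mathcomp Require Import all_classical all_reals all_analysis.
Import Order.TTheory GRing.Theory Num.Theory.
Import numFieldNormedType.Exports.

Set Implicit Arguments.
Unset Strict Implicit.
Unset Printing Implicit Defensive.

Local Open Scope classical_set_scope.
Local Open Scope ring_scope.

Definition dot (R : realType) (u v : 'rV[R]_3) : R := \sum_k u 0 k * v 0 k.

(* The library norm `|u| on 'rV[R]_3 is the max norm, not the Euclidean one. *)
Definition enorm (R : realType) (u : 'rV[R]_3) : R := Num.sqrt (dot u u).

(* Indices are added in the ring 'I_3, that is modulo 3. *)
Definition cross (R : realType) (u v : 'rV[R]_3) : 'rV[R]_3 :=
  \row_k (u 0 (k + 1) * v 0 (k + 2) - u 0 (k + 2) * v 0 (k + 1)).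

Definition orthonormal3 (R : realType) (u v w : 'rV[R]_3) : Prop :=
  [/\ enorm u = 1, enorm v = 1 & enorm w = 1] /\
  [/\ dot u v = 0, dot v w = 0 & dot u w = 0].

(* Pairs (scalar part, vector part); addition and real scaling are those of
   the product module. *)
Definition quat (R : realType) : lmodType R := (R^o * 'rV[R]_3)%type.

Definition scal (R : realType) (a : quat R) : R := a.1.
Definition vect (R : realType) (a : quat R) : 'rV[R]_3 := a.2.
Definition quat_of_vec (R : realType) (u : 'rV[R]_3) : quat R := (0, u).

Definition qmul (R : realType) (a b : quat R) : quat R :=
  (scal a * scal b - dot (vect a) (vect b),
   scal a *: vect b + scal b *: vect a + cross (vect a) (vect b)).

Definition qconj (R : realType) (a : quat R) : quat R := (scal a, - vect a).

(* The quaternion a i c^*, where i is a pure vector. *)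
Definition sandwich (R : realType) (i : 'rV[R]_3) (a c : quat R) : quat R :=
  qmul (qmul a (quat_of_vec i)) (qconj c).

Definition bernstein (R : realType) (n k : nat) (t : R) : R :=
  'C(n, k)%:R * t ^+ k * (1 - t) ^+ (n - k).

Definition quat_curve (R : realType) (A0 A1 A2 : quat R) (t : R) : quat R :=
  bernstein 2 0 t *: A0 + bernstein 2 1 t *: A1 + bernstein 2 2 t *: A2.

(* A polynomial curve is given by its three coordinate polynomials. *)
Definition curve_point (R : realType) (r : 'rV[{poly R}]_3) (t : R) : 'rV[R]_3 :=
  \row_k (r 0 k).[t].

Definition velocity (R : realType) (r : 'rV[{poly R}]_3) (t : R) : 'rV[R]_3 :=
  \row_k ((r 0 k)^`()).[t].

Definition RRMF5_I (R : realType) (i : 'rV[R]_3) (r : 'rV[{poly R}]_3) : Prop :=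
  exists A0 A1 A2 : quat R,
    (forall t, 0 <= t <= 1 ->
       quat_of_vec (velocity r t) =
       sandwich i (quat_curve A0 A1 A2 t) (quat_curve A0 A1 A2 t)) /\
    sandwich i A1 A1 = quat_of_vec (vect (sandwich i A2 A0)).

(* Since 0^-1 = 0, the unit length of f1 forces the velocity of r not to
   vanish on [0, 1]. *)
Definition adapted_frame (R : realType) (r : 'rV[{poly R}]_3)
    (f1 f2 f3 : R -> 'rV[R]_3) : Prop :=
  forall t, 0 <= t <= 1 ->
    orthonormal3 (f1 t) (f2 t) (f3 t) /\
    f1 t = (enorm (velocity r t))^-1 *: velocity r t.

(* l is the derivative at t of the restriction of f to [0, 1]; it is one-sided
   at the end points. *)
Definition is_deriv01 (R : realType) (f : R -> 'rV[R]_3) (t : R)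
    (l : 'rV[R]_3) : Prop :=
  (s - t)^-1 *: (f s - f t) @[s --> within `[0, 1] t^'] --> l.

Definition rotation_minimizing (R : realType)
    (f1 f2 f3 : R -> 'rV[R]_3) : Prop :=
  forall t, 0 <= t <= 1 ->
    (exists a : R, is_deriv01 f2 t (a *: f1 t)) /\
    (exists b : R, is_deriv01 f3 t (b *: f1 t)).

Definition rational01 (R : realType) (f : R -> 'rV[R]_3) : Prop :=
  forall k : 'I_3, exists p q : {poly R},
    forall t, 0 <= t <= 1 -> q.[t] != 0 /\ f t 0 k = p.[t] / q.[t].

Definition rational_RMF (R : realType) (r : 'rV[{poly R}]_3)
    (f1 f2 f3 : R -> 'rV[R]_3) : Prop :=
  [/\ adapted_frame r f1 f2 f3,
      rotation_minimizing f1 f2 f3 &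
      [/\ rational01 f1, rational01 f2 & rational01 f3]].

(* Main.v *)
Require Import Defs.
From mathcomp Require Import all_boot all_order all_algebra.
From mathcomp Require Import all_classical all_reals all_analysis.
From mathcomp Require Import ring lra.
Import Order.TTheory GRing.Theory Num.Theory.
Import numFieldNormedType.Exports.

(** Write a hodograph of the class as A i A^*, A quadratic with Bernstein
    coefficients A0, A1, A2.  Since A i A^* = (A C^-1) (C i C^* ) (A C^-1)^*,
    multiplying A on the right by a constant only changes the axis i.  With
    C = A0 the axis becomes mu^2 u, where u is the initial tangent, and A0
    becomes 1.  In a right-handed orthonormal frame (u, n, l), with n along the
    part of A1 normal to u, one has A1 = x + y u + z n, and the algebraic
    condition on A0, A1, A2 says exactly that
      A2 = (x^2 + y^2 - z^2) + m u + 2 x z n + 2 y z l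
    for some real m ([RRMF5_I_normal_form]).  So up to position and scale a
    curve of the class is given by (x, y, z, m).

    Put a = x^2 + y^2 and b = z^2.  Then the final tangent u_f is a unit vector
    iff (a + b)^2 + m^2 = 1, and in that case u . u_f = 1 - 8ab.  The two ends
    make equal angles with the chord iff z (y m - x (1 - a - b)) = 0
    ([chord_balanceE]), where z <> 0 as u and u_f are not parallel.  Under this
    balance, five times the component of the chord along u is
    D = 2 + a - b - 8ab + 2x(1 - 2b).

    Necessity.  If D >= 0 then tau <= pi/2.  If D < 0, then
    ab > k^2 (1 - k^2) with k = cos(2 pi/5) ([axis_chord_ge0]), where
    4k^2 + 2k - 1 = 0.  By balance and the Cauchy-Schwarz inequality,
    4 cos^2 tau <= |u + u_f|^2 = 4 (1 - 4ab), so that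
    cos^2 tau < 1 - 4k^2 (1 - k^2) = (1 - 2k^2)^2 = cos^2(4 pi/5).

    Sufficiency.  Taking x = cos(tau/2), z = sin(tau/2), y = m = 0 gives a
    planar chord, a multiple of cos tau u - sin tau l by 4x^2 + 2x - 1, and
    this factor is positive precisely when tau/2 < 2 pi/5.  In this family
    tau = pi/2 would give u_f = - u, so a spatial solution is exhibited for
    that angle ([ex_normal_form_chord]).  The chord is brought to its prescribed
    position by the choice of n and of the scale mu ([RRMF5_I_interpolant]).

    The frame.  Let W be the quadratic with values in the plane R + R u whose
    Bernstein coefficients are 1, x + y u and (a + b) + m u.  Then |W|^2 = |A|^2
    and the frames carried by A and by W have the same rate of rotation about
    the tangent, so that rotating along F = A W^* removes it:
    v -> F v F^* / |F|^2 maps an orthonormal triple (u, v, w) of either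
    orientation to a rational rotation-minimizing frame that starts at
    (u, v, w) ([rmf_field_rational_RMF]).  As F is polynomial, its components
    are rational. *)

Set Implicit Arguments.
Unset Strict Implicit.
Unset Printing Implicit Defensive.

Local Open Scope ring_scope.

(** * Euclidean vectors, frames and quaternions in coordinates *)

Section Vectors.
Variable R : realType.
Implicit Types (u v w n l : 'rV[R]_3).

Lemma row3P u v :
  u 0 0 = v 0 0 -> u 0 1 = v 0 1 -> u 0 2 = v 0 2 -> u = v.
Proof.
move=> e0 e1 e2; apply/rowP => k.
by case: k => [[|[|[|//]]] hk]; [move: e0|move: e1|move: e2];
  congr (u 0 _ = v 0 _); apply: val_inj.
Qed.

Lemma dotE u v : dot u v = u 0 0 * v 0 0 + u 0 1 * v 0 1 + u 0 2 * v 0 2.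
Proof.
rewrite /dot !big_ord_recl big_ord0 addr0 addrA.
by congr (u 0 _ * v 0 _ + u 0 _ * v 0 _ + u 0 _ * v 0 _); apply: val_inj.
Qed.

Lemma crossE u v :
  [/\ cross u v 0 0 = u 0 1 * v 0 2 - u 0 2 * v 0 1,
      cross u v 0 1 = u 0 2 * v 0 0 - u 0 0 * v 0 2 &
      cross u v 0 2 = u 0 0 * v 0 1 - u 0 1 * v 0 0].
Proof.
by split; rewrite mxE; congr (u 0 _ * v 0 _ - u 0 _ * v 0 _); apply: val_inj.
Qed.
Definition cross0E u v := let: And3 h _ _ := crossE u v in h.
Definition cross1E u v := let: And3 _ h _ := crossE u v in h.
Definition cross2E u v := let: And3 _ _ h := crossE u v in h.

Let coordE := (cross0E, cross1E, cross2E, mxE).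

Lemma dotC u v : dot u v = dot v u.
Proof. by rewrite !dotE; ring. Qed.
Lemma dotDl u v w : dot (u + v) w = dot u w + dot v w.
Proof. by rewrite !dotE !coordE; ring. Qed.
Lemma dotDr u v w : dot w (u + v) = dot w u + dot w v.
Proof. by rewrite !dotE !coordE; ring. Qed.
Lemma dotZl a u v : dot (a *: u) v = a * dot u v.
Proof. by rewrite !dotE !coordE; ring. Qed.
Lemma dotZr a u v : dot u (a *: v) = a * dot u v.
Proof. by rewrite !dotE !coordE; ring. Qed.

Lemma dotvv_ge0 u : 0 <= dot u u.
Proof. by rewrite dotE -!expr2 !addr_ge0 ?sqr_ge0. Qed.
Lemma dotvv_eq0 u : dot u u = 0 -> u = 0.
Proof.
rewrite dotE => h.
by apply: row3P; rewrite mxE; nra.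
Qed.
Lemma dotvv_gt0 u : u != 0 -> 0 < dot u u.
Proof.
move=> u0; rewrite lt_def dotvv_ge0 andbT.
by apply: contra_neq u0; exact: dotvv_eq0.
Qed.

Lemma sqr_enorm u : enorm u ^+ 2 = dot u u.
Proof. by rewrite /enorm sqr_sqrtr// dotvv_ge0. Qed.
Lemma enorm_gt0 u : u != 0 -> 0 < enorm u.
Proof. by move=> u0; rewrite /enorm sqrtr_gt0 dotvv_gt0. Qed.
Lemma enorm1P u : enorm u = 1 <-> dot u u = 1.
Proof.
split=> h; first by rewrite -sqr_enorm h expr1n.
by rewrite /enorm h sqrtr1.
Qed.
Lemma enormZ a u : 0 <= a -> enorm (a *: u) = a * enorm u.
Proof.
move=> a0; rewrite /enorm dotZl dotZr mulrA -expr2 sqrtrM ?sqr_ge0//.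
by rewrite sqrtr_sqr ger0_norm.
Qed.

Lemma dot_cauchy u v : dot u v ^+ 2 <= dot u u * dot v v.
Proof.
rewrite -subr_ge0.
have -> : dot u u * dot v v - dot u v ^+ 2 = dot (cross u v) (cross u v).
  by rewrite !dotE !coordE; ring.
exact: dotvv_ge0.
Qed.

Lemma ex_unit_perp u : exists2 n, dot n n = 1 & dot u n = 0.
Proof.
have [w w0 uw] : exists2 w, w != 0 & dot u w = 0.
  (* A cross product with the first basis vector works unless u is parallel to
     that vector; then the second basis vector works. *)
  have [e|ne] := eqVneq (cross u (delta_mx 0 0)) 0; last first.
    by exists (cross u (delta_mx 0 0)) => //; rewrite dotE !coordE; ring.
  exists (delta_mx 0 1).
    apply/eqP => /rowP/(_ 1); rewrite !mxE/= => /eqP; by rewrite oner_eq0.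
  have /rowP/(_ 2) := e; rewrite cross2E !mxE/= => h.
  rewrite dotE !mxE/=; lra.
exists ((enorm w)^-1 *: w); last by rewrite dotZr uw mulr0.
rewrite dotZl dotZr -sqr_enorm; field.
by rewrite gt_eqF// enorm_gt0.
Qed.

Definition rframe u n l :=
  [/\ dot u u = 1, dot n n = 1, dot u n = 0 & l = cross u n].

Definition comb u n l (a b c : R) := a *: u + b *: n + c *: l.

Lemma cross_cross u v w : cross u (cross v w) = dot u w *: v - dot u v *: w.
Proof. by apply: row3P; rewrite !coordE !dotE; ring. Qed.
Lemma cross_anti u v : cross u v = - cross v u.
Proof. by apply: row3P; rewrite !coordE; ring. Qed.
Lemma crossDl u v w : cross (u + v) w = cross u w + cross v w.
Proof. by apply: row3P; rewrite !coordE; ring. Qed.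
Lemma crossDr u v w : cross w (u + v) = cross w u + cross w v.
Proof. by apply: row3P; rewrite !coordE; ring. Qed.
Lemma crossZl a u v : cross (a *: u) v = a *: cross u v.
Proof. by apply: row3P; rewrite !coordE; ring. Qed.
Lemma crossZr a u v : cross u (a *: v) = a *: cross u v.
Proof. by apply: row3P; rewrite !coordE; ring. Qed.
Lemma crossvv u : cross u u = 0.
Proof. by apply: row3P; rewrite !coordE; ring. Qed.
Lemma dot_crossl u v : dot u (cross u v) = 0.
Proof. by rewrite dotE !coordE; ring. Qed.
Lemma dot_crossr u v : dot v (cross u v) = 0.
Proof. by rewrite dotE !coordE; ring. Qed.
Lemma dot_cross_cross u v :
  dot (cross u v) (cross u v) = dot u u * dot v v - dot u v ^+ 2.
Proof. by rewrite !dotE !coordE; ring. Qed.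

Section Frame.
Variables u n l : 'rV[R]_3.
Hypothesis F : rframe u n l.

Let uu : dot u u = 1. Proof. by case: F. Qed.
Let nn : dot n n = 1. Proof. by case: F. Qed.
Let un : dot u n = 0. Proof. by case: F. Qed.
Let ll : dot l l = 1.
Proof. by case: F => _ _ _ ->; rewrite dot_cross_cross uu nn un; ring. Qed.
Let ul : dot u l = 0. Proof. by case: F => _ _ _ ->; exact: dot_crossl. Qed.
Let nl : dot n l = 0. Proof. by case: F => _ _ _ ->; exact: dot_crossr. Qed.
Let cun : cross u n = l. Proof. by case: F. Qed.
Let cnl : cross n l = u.
Proof. by rewrite -cun cross_cross nn dotC un scale1r scale0r subr0. Qed.
Let clu : cross l u = n.
Proof.
by rewrite cross_anti -cun cross_cross un uu scale1r scale0r sub0r opprK.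
Qed.

Lemma dot_comb a b c a' b' c' :
  dot (comb u n l a b c) (comb u n l a' b' c') = a * a' + b * b' + c * c'.
Proof.
rewrite /comb !(dotDl, dotDr, dotZl, dotZr) uu nn ll.
rewrite (dotC n u) (dotC l u) (dotC l n) un ul nl; ring.
Qed.

Lemma cross_comb a b c a' b' c' :
  cross (comb u n l a b c) (comb u n l a' b' c') =
  comb u n l (b * c' - c * b') (c * a' - a * c') (a * b' - b * a').
Proof.
rewrite /comb !(crossDl, crossDr, crossZl, crossZr) !crossvv.
rewrite (cross_anti n u) (cross_anti l n) (cross_anti u l) cun cnl clu.
by apply: row3P; rewrite !mxE; ring.
Qed.

Lemma comb1 : comb u n l 1 0 0 = u.
Proof. by rewrite /comb scale1r !scale0r !addr0. Qed.
Lemma comb2 : comb u n l 0 1 0 = n.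
Proof. by rewrite /comb scale1r !scale0r add0r addr0. Qed.
Lemma comb3 : comb u n l 0 0 1 = l.
Proof. by rewrite /comb scale1r !scale0r !add0r. Qed.

Lemma comb_inj a b c a' b' c' : comb u n l a b c = comb u n l a' b' c' ->
  [/\ a = a', b = b' & c = c'].
Proof.
move=> e; have h v : dot v (comb u n l a b c) = dot v (comb u n l a' b' c').
  by rewrite e.
have := (h (comb u n l 1 0 0), h (comb u n l 0 1 0), h (comb u n l 0 0 1)).
by rewrite !dot_comb => -[[h1 h2] h3]; split; lra.
Qed.

(** For all vectors u, n, l one has (u . (n x l)) v =
    (u . v) (n x l) + (n . v) (l x u) + (l . v) (u x n); in a right-handed
    orthonormal frame the three cross products are u, n, l themselves. *)
Lemma comb_span v : v = comb u n l (dot u v) (dot n v) (dot l v).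
Proof.
have : dot u (cross n l) *: v =
    dot u v *: cross n l + dot n v *: cross l u + dot l v *: cross u n.
  by apply: row3P; rewrite !(coordE, dotE); ring.
by rewrite cnl clu cun uu scale1r.
Qed.

End Frame.

Lemma combD u n l a b c a' b' c' : comb u n l a b c + comb u n l a' b' c' =
  comb u n l (a + a') (b + b') (c + c').
Proof. by apply: row3P; rewrite !mxE; ring. Qed.
Lemma combZ u n l k a b c :
  k *: comb u n l a b c = comb u n l (k * a) (k * b) (k * c).
Proof. by apply: row3P; rewrite !mxE; ring. Qed.
Lemma combN u n l a b c : - comb u n l a b c = comb u n l (- a) (- b) (- c).
Proof. by apply: row3P; rewrite !mxE; ring. Qed.

Implicit Types A B C : quat R.

Lemma quatP A B : A.1 = B.1 -> A.2 = B.2 -> A = B.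
Proof. by case: A B => [a v] [b w] /= -> ->. Qed.

Lemma qmulA A B C : qmul A (qmul B C) = qmul (qmul A B) C.
Proof.
apply: quatP; rewrite /qmul/scal/vect/=.
  by rewrite !(coordE, dotE); ring.
by apply: row3P; rewrite !(coordE, dotE); ring.
Qed.

Lemma qconj_qmul A B : qconj (qmul A B) = qmul (qconj B) (qconj A).
Proof.
apply: quatP; rewrite /qmul/qconj/scal/vect/=.
  by rewrite !(coordE, dotE); ring.
by apply: row3P; rewrite !(coordE, dotE); ring.
Qed.

Definition qnorm A := A.1 ^+ 2 + dot A.2 A.2.

Lemma qmul_conjl A : qmul (qconj A) A = (qnorm A, 0).
Proof.
apply: quatP; rewrite /qmul/qconj/scal/vect/=/qnorm.
  by rewrite !(coordE, dotE); ring.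
by apply: row3P; rewrite !(coordE, dotE); ring.
Qed.
Lemma qmul_conjr A : qmul A (qconj A) = (qnorm A, 0).
Proof.
apply: quatP; rewrite /qmul/qconj/scal/vect/=/qnorm.
  by rewrite !(coordE, dotE); ring.
by apply: row3P; rewrite !(coordE, dotE); ring.
Qed.

Lemma qnormM A B : qnorm (qmul A B) = qnorm A * qnorm B.
Proof.
by rewrite /qnorm/qmul/scal/vect/= !dotE !(coordE, dotE); ring.
Qed.
Lemma qnorm_conj A : qnorm (qconj A) = qnorm A.
Proof. by rewrite /qnorm/qconj/scal/vect/= !dotE !mxE; ring. Qed.

Lemma qmulr_real A (k : R) : qmul A (k, 0) = k *: A.
Proof.
apply: quatP; rewrite /qmul/scal/vect/=.
  by rewrite dotE !mxE !mulr0 !addr0 subr0 mulrC.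
by apply: row3P; rewrite !coordE; ring.
Qed.

Lemma qmulDl A B C : qmul (A + B) C = qmul A C + qmul B C.
Proof.
apply: quatP; rewrite /qmul/scal/vect/=.
  by rewrite !(coordE, dotE); ring.
by apply: row3P; rewrite !coordE; ring.
Qed.
Lemma qmulZl k A C : qmul (k *: A) C = k *: qmul A C.
Proof.
apply: quatP; rewrite /qmul/scal/vect/=.
  by rewrite !dotE !mxE /GRing.scale/=; ring.
by apply: row3P; rewrite !coordE/GRing.scale/=; ring.
Qed.
Lemma qmulZr k A C : qmul A (k *: C) = k *: qmul A C.
Proof.
apply: quatP; rewrite /qmul/scal/vect/=.
  by rewrite !dotE !mxE /GRing.scale/=; ring.
by apply: row3P; rewrite !coordE/GRing.scale/=; ring.
Qed.

(** (A C) i (B C)^* = A (C i C^* ) B^*, so that a common right factor of the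
    preimages only changes the axis; this reduces the general case to A0 = 1. *)
Lemma sandwich_mulr i u k A B C : sandwich i C C = quat_of_vec (k *: u) ->
  sandwich i (qmul A C) (qmul B C) = k *: sandwich u A B.
Proof.
rewrite /sandwich => e; rewrite qconj_qmul -!qmulA.
have -> : qmul C (qmul (quat_of_vec i) (qmul (qconj C) (qconj B))) =
          qmul (quat_of_vec (k *: u)) (qconj B) by rewrite -e !qmulA.
have -> : quat_of_vec (k *: u) = k *: quat_of_vec u.
  by rewrite /quat_of_vec; apply: quatP => //=; rewrite /GRing.scale/= mulr0.
by rewrite qmulZl qmulZr.
Qed.

Lemma qnorm_sandwich i A : qnorm (sandwich i A A) = qnorm A ^+ 2 * dot i i.
Proof. by rewrite !qnormM qnorm_conj /qnorm/=; ring. Qed.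

Section FrameQuat.
Variables u n l : 'rV[R]_3.
Hypothesis F : rframe u n l.

Definition fquat (s a b c : R) : quat R := (s, comb u n l a b c).

Lemma qmul_fquat s a b c s' a' b' c' :
  qmul (fquat s a b c) (fquat s' a' b' c') =
  fquat (s * s' - (a * a' + b * b' + c * c'))
     (s * a' + s' * a + (b * c' - c * b'))
     (s * b' + s' * b + (c * a' - a * c'))
     (s * c' + s' * c + (a * b' - b * a')).
Proof.
by rewrite /qmul/fquat/scal/vect/= (dot_comb F) (cross_comb F) !combZ !combD.
Qed.

Lemma qconj_fquat s a b c : qconj (fquat s a b c) = fquat s (- a) (- b) (- c).
Proof. by rewrite /qconj/fquat/scal/vect/= combN. Qed.

Lemma fquatD s a b c s' a' b' c' : fquat s a b c + fquat s' a' b' c' =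
  fquat (s + s') (a + a') (b + b') (c + c').
Proof. by rewrite /fquat -combD. Qed.
Lemma fquatZ k s a b c :
  k *: fquat s a b c = fquat (k * s) (k * a) (k * b) (k * c).
Proof. by rewrite /fquat -combZ. Qed.

Lemma sandwich_fquat s a b c : sandwich u (fquat s a b c) (fquat s a b c) =
  quat_of_vec (comb u n l (s ^+ 2 + a ^+ 2 - b ^+ 2 - c ^+ 2)
                 (2 * (a * b + s * c)) (2 * (a * c - s * b))).
Proof.
have e : quat_of_vec u = fquat 0 1 0 0.
  by rewrite /fquat (comb1 u n l) /quat_of_vec.
rewrite /sandwich e qconj_fquat !qmul_fquat /fquat/quat_of_vec.
by congr pair; [ring | congr comb; ring].
Qed.

(** The quaternion A u, whose vector part is the right-hand side of the
    RRMF5-I condition once A0 = 1. *)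
Lemma sandwich_fquat1 s a b c : sandwich u (fquat s a b c) (fquat 1 0 0 0) =
  fquat (- a) s c (- b).
Proof.
have e : quat_of_vec u = fquat 0 1 0 0.
  by rewrite /fquat (comb1 u n l) /quat_of_vec.
by rewrite /sandwich e qconj_fquat !qmul_fquat; congr fquat; ring.
Qed.

End FrameQuat.
End Vectors.

(** * Hodographs in normal form and their chords *)

Section Curve.
Variable R : realType.
Implicit Types (u v w n l : 'rV[R]_3).

(** Each quartic Bernstein polynomial has integral 1/5 over the unit interval.
    The antiderivative P is written in the power basis; the derivative of
    5 p - P vanishes there, and the mean value theorem concludes. *)
Lemma poly_increment (p : {poly R}) (c0 c1 c2 c3 c4 : R) :
  (forall t, 0 <= t <= 1 -> p^`().[t] =
     c0 * (1 - t) ^+ 4 + 4 * c1 * t * (1 - t) ^+ 3 +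
     6 * c2 * t ^+ 2 * (1 - t) ^+ 2 + 4 * c3 * t ^+ 3 * (1 - t) +
     c4 * t ^+ 4) ->
  p.[1] - p.[0] = (c0 + c1 + c2 + c3 + c4) / 5.
Proof.
move=> dp.
pose P : {poly R} :=
  (5 * c0) *: 'X + (10 * (c1 - c0)) *: 'X ^+ 2 +
  (10 * (c0 - 2 * c1 + c2)) *: 'X ^+ 3 +
  (5 * (- c0 + 3 * c1 - 3 * c2 + c3)) *: 'X ^+ 4 +
  (c0 - 4 * c1 + 6 * c2 - 4 * c3 + c4) *: 'X ^+ 5.
pose d := 5 *: p - P.
have [k k01 dk] : exists2 k, k \in `]0, 1[ &
    horner d 1 - horner d 0 = horner (d^`()) k * (1 - 0).
  apply: (@MVT _ (horner d) (horner (d^`()))) => //; last first.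
    by apply: continuous_subspaceT; exact: continuous_horner.
have {}dk : d.[1] - d.[0] = 0.
  rewrite dk subr0 mulr1 /d derivB derivZ /P !derivD !derivZ !derivXn derivX.
  rewrite !(hornerD, hornerN, hornerZ, hornerMn, hornerXn, hornerC) dp/=.
    by ring.
  by move: k01; rewrite in_itv/= => /andP[/ltW-> /ltW->].
have : d.[1] - d.[0] = 5 * (p.[1] - p.[0]) - (c0 + c1 + c2 + c3 + c4).
  by rewrite /d /P !(hornerD, hornerN, hornerZ, hornerXn, hornerX); ring.
rewrite dk => h; lra.
Qed.

(** The coordinates in (1, u, n, l) of the preimage with Bernstein coefficients
    1, x + y u + z n and (x^2 + y^2 - z^2) + m u + 2 x z n + 2 y z l. *)
Definition pre0 (x y z : R) : {poly R} :=
  (1 - 'X) ^+ 2 + (2 * x) *: ('X * (1 - 'X)) +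
  (x ^+ 2 + y ^+ 2 - z ^+ 2) *: 'X ^+ 2.
Definition pre1 (y m : R) : {poly R} :=
  (2 * y) *: ('X * (1 - 'X)) + m *: 'X ^+ 2.
Definition pre2 (x z : R) : {poly R} :=
  (2 * z) *: ('X * (1 - 'X)) + (2 * x * z) *: 'X ^+ 2.
Definition pre3 (y z : R) : {poly R} := (2 * y * z) *: 'X ^+ 2.

Lemma pre0E x y z t : (pre0 x y z).[t] =
  (1 - t) ^+ 2 + 2 * x * (t * (1 - t)) + (x ^+ 2 + y ^+ 2 - z ^+ 2) * t ^+ 2.
Proof. by rewrite /pre0 !hornerE. Qed.
Lemma pre1E y m t : (pre1 y m).[t] = 2 * y * (t * (1 - t)) + m * t ^+ 2.
Proof. by rewrite /pre1 !hornerE. Qed.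
Lemma pre2E x z t : (pre2 x z).[t] = 2 * z * (t * (1 - t)) + 2 * x * z * t ^+ 2.
Proof. by rewrite /pre2 !hornerE. Qed.
Lemma pre3E y z t : (pre3 y z).[t] = 2 * y * z * t ^+ 2.
Proof. by rewrite /pre3 !hornerE. Qed.

Definition hodograph u n l (x y z m t : R) : 'rV[R]_3 :=
  let q0 := (pre0 x y z).[t] in let q1 := (pre1 y m).[t] in
  let q2 := (pre2 x z).[t] in let q3 := (pre3 y z).[t] in
  comb u n l (q0 ^+ 2 + q1 ^+ 2 - q2 ^+ 2 - q3 ^+ 2)
    (2 * (q1 * q2 + q0 * q3)) (2 * (q1 * q3 - q0 * q2)).


Definition end_tangent u n l (x y z m : R) : 'rV[R]_3 :=
  let p := x ^+ 2 + y ^+ 2 - z ^+ 2 in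
  comb u n l (p ^+ 2 + m ^+ 2 - 4 * z ^+ 2 * (x ^+ 2 + y ^+ 2))
    (4 * z * (x * m + y * p)) (4 * z * (y * m - x * p)).

Lemma hodograph0 u n l x y z m : hodograph u n l x y z m 0 = u.
Proof.
rewrite /hodograph pre0E pre1E pre2E pre3E -[RHS](comb1 u n l).
by congr comb; ring.
Qed.

Lemma hodograph1 u n l x y z m :
  hodograph u n l x y z m 1 = end_tangent u n l x y z m.
Proof.
rewrite /hodograph pre0E pre1E pre2E pre3E /end_tangent.
by congr comb; ring.
Qed.

(** Five times the integral of the hodograph, each coordinate being the sum of
    its Bernstein coefficients. *)
Definition chord u n l (x y z m : R) : 'rV[R]_3 :=
  let p := x ^+ 2 + y ^+ 2 - z ^+ 2 in
  comb u n l
    (1 + x + p + (x * p + y * m - 2 * x * z ^+ 2) +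
     (p ^+ 2 + m ^+ 2 - 4 * z ^+ 2 * (x ^+ 2 + y ^+ 2)))
    (z * (2 * y + 4 * x * y + m + 4 * (x * m + y * p)))
    (z * (- 1 - 2 * x + 2 * y ^+ 2 - 2 * x ^+ 2 - p + 4 * (y * m - x * p))).

(** The increment of r along each frame vector is that of a scalar polynomial,
    to which [poly_increment] applies with the Bernstein coefficients of the
    corresponding coordinate of the hodograph. *)
Lemma chordP u n l x y z m k (r : 'rV[{poly R}]_3) : rframe u n l ->
  (forall t, 0 <= t <= 1 -> velocity r t = k *: hodograph u n l x y z m t) ->
  curve_point r 1 - curve_point r 0 = (k / 5) *: chord u n l x y z m.
Proof.
move=> F vr.
have dot_chord v : dot v (curve_point r 1 - curve_point r 0) =
    (v 0 0 *: r 0 0 + v 0 1 *: r 0 1 + v 0 2 *: r 0 2).[1] -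
    (v 0 0 *: r 0 0 + v 0 1 *: r 0 1 + v 0 2 *: r 0 2).[0].
  by rewrite dotE !mxE !hornerE; ring.
have der v t : 0 <= t <= 1 ->
    (v 0 0 *: r 0 0 + v 0 1 *: r 0 1 + v 0 2 *: r 0 2)^`().[t] =
    k * dot v (hodograph u n l x y z m t).
  move=> t01; rewrite -dotZr -vr// dotE !mxE.
  by rewrite !derivD !derivZ !hornerE.
rewrite [LHS](comb_span F) /chord combZ; congr comb; rewrite dot_chord.
- rewrite (@poly_increment _ k (k * x) (k * (x ^+ 2 + y ^+ 2 - z ^+ 2))
    (k * (x * (x ^+ 2 + y ^+ 2 - z ^+ 2) + y * m - 2 * x * z ^+ 2))
    (k * ((x ^+ 2 + y ^+ 2 - z ^+ 2) ^+ 2 + m ^+ 2 -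
          4 * z ^+ 2 * (x ^+ 2 + y ^+ 2)))); first by ring.
  move=> t t01; rewrite der// -{1}(comb1 u n l) (dot_comb F).
  by rewrite pre0E pre1E pre2E pre3E; ring.
- rewrite (@poly_increment _ 0 0 (k * (2 * y * z)) (k * (4 * x * y * z + m * z))
    (k * (4 * z * (x * m + y * (x ^+ 2 + y ^+ 2 - z ^+ 2))))); first by ring.
  move=> t t01; rewrite der// -{1}(comb2 u n l) (dot_comb F).
  by rewrite pre0E pre1E pre2E pre3E; ring.
- rewrite (@poly_increment _ 0 (- k * z) (k * (- 2 * x * z))
    (k * z * (2 * y ^+ 2 - 2 * x ^+ 2 - (x ^+ 2 + y ^+ 2 - z ^+ 2)))
    (k * (4 * z * (y * m - x * (x ^+ 2 + y ^+ 2 - z ^+ 2))))); first by ring.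
  move=> t t01; rewrite der// -{1}(comb3 u n l) (dot_comb F).
  by rewrite pre0E pre1E pre2E pre3E; ring.
Qed.

Definition quat_preimage u n l (x y z m t : R) : quat R :=
  quat_curve (fquat u n l 1 0 0 0) (fquat u n l x y z 0)
    (fquat u n l (x ^+ 2 + y ^+ 2 - z ^+ 2) m (2 * x * z) (2 * y * z)) t.

Lemma quat_preimageE u n l x y z m t : quat_preimage u n l x y z m t =
  fquat u n l (pre0 x y z).[t] (pre1 y m).[t] (pre2 x z).[t] (pre3 y z).[t].
Proof.
rewrite /quat_preimage /quat_curve !fquatZ !fquatD /bernstein.
rewrite pre0E pre1E pre2E pre3E.
by congr fquat; rewrite !binE; ring.
Qed.

Lemma sandwich_quat_preimage u n l x y z m t : rframe u n l ->
  sandwich u (quat_preimage u n l x y z m t) (quat_preimage u n l x y z m t) =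
  quat_of_vec (hodograph u n l x y z m t).
Proof. by move=> F; rewrite quat_preimageE (sandwich_fquat F). Qed.

End Curve.

(** * Reduction of an RRMF5-I hodograph to normal form *)

Section Necessity.
Variable R : realType.
Implicit Types (i u v w n l : 'rV[R]_3) (A B C : quat R).

(** n is the direction of the part of v normal to u, and any unit normal vector
    when that part vanishes. *)
Lemma ex_aligned_rframe u v : dot u u = 1 ->
  exists n l (y z : R), rframe u n l /\ v = comb u n l y z 0.
Proof.
move=> uu; have [n nn un] := ex_unit_perp u.
pose w := v - dot u v *: u.
have uw : dot u w = 0 by rewrite dotDr -scaleNr dotZr uu; ring.
have [w0|w0] := eqVneq w 0.
  exists n, (cross u n), (dot u v), 0; split=> //.
  by rewrite /comb !scale0r !addr0; apply/eqP; rewrite -subr_eq0 -/w w0.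
exists ((enorm w)^-1 *: w), (cross u ((enorm w)^-1 *: w)), (dot u v), (enorm w).
have ew : enorm w != 0 by rewrite gt_eqF// enorm_gt0.
split.
  by split=> //; rewrite !(dotZr, dotZl) ?uw ?mulr0// -sqr_enorm; field.
by rewrite /comb scalerA divff// scale1r scale0r addr0 addrC subrK.
Qed.

Lemma quat_curve_qmul A0 A1 A2 C t :
  quat_curve (qmul A0 C) (qmul A1 C) (qmul A2 C) t =
  qmul (quat_curve A0 A1 A2 t) C.
Proof. by rewrite /quat_curve !qmulDl !qmulZl. Qed.

Lemma quat_of_vecZ k v : quat_of_vec (k *: v) = k *: quat_of_vec v.
Proof. by rewrite /quat_of_vec; apply: quatP => //=; rewrite scaler0. Qed.

Lemma quat_curve0 A0 A1 A2 : quat_curve A0 A1 A2 0 = A0.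
Proof.
rewrite /quat_curve /bernstein !expr0n/= !mulr0 !mul0r !scale0r !addr0 subr0.
by rewrite expr1n !mulr1 scale1r.
Qed.

(** Dividing the preimage on the right by A0 replaces the axis i by mu^2 u and
    A0 by 1.  Align the frame with the new A1 = x + y u + z n: then
    A1 u A1^* = vect (A2 u) determines three of the four coordinates of A2, and
    m is the remaining one, the component along u. *)
Lemma RRMF5_I_normal_form i u (mu : R) (r : 'rV[{poly R}]_3) :
  dot i i = 1 -> dot u u = 1 -> 0 < mu ->
  velocity r 0 = mu ^+ 2 *: u -> RRMF5_I i r ->
  exists n l (x y z m : R), rframe u n l /\
    forall t, 0 <= t <= 1 ->
      velocity r t = mu ^+ 2 *: hodograph u n l x y z m t.
Proof.
move=> ii uu mu0 vr0 [A0 [A1 [A2 [vr cond]]]].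
have mu2 : mu ^+ 2 != 0 by rewrite expf_neq0// gt_eqF.
have s0 : sandwich i A0 A0 = quat_of_vec (mu ^+ 2 *: u).
  by rewrite -vr0 vr ?lexx ?ler01// quat_curve0.
(* The squared norm of A0 is the length of A0 i A0^*. *)
have nA0 : qnorm A0 = mu ^+ 2.
  have := qnorm_sandwich i A0.
  rewrite s0 ii mulr1 {1}/qnorm/= dotZl dotZr uu expr0n add0r mulr1 -expr2.
  move/eqP; rewrite eqf_sqr => /orP[/eqP->//|/eqP h].
  have : 0 <= qnorm A0 by rewrite addr_ge0 ?sqr_ge0 ?dotvv_ge0.
  have : 0 < mu ^+ 2 by rewrite exprn_gt0.
  by rewrite h; lra.
pose nf A := qmul A ((mu ^+ 2)^-1 *: qconj A0).
have nfK A : qmul (nf A) A0 = A.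
  rewrite /nf -qmulA qmulZl qmul_conjl qmulZr qmulr_real nA0 scalerA.
  by rewrite mulVf// scale1r.
have nf0 : nf A0 = (1, 0).
  rewrite /nf qmulZr qmul_conjr nA0; apply: quatP => /=.
    by rewrite /GRing.scale/= mulVf.
  by rewrite scaler0.
have [n [l [y [z [F e1]]]]] := ex_aligned_rframe (nf A1).2 uu.
have [x ex] : exists x : R, x = (nf A1).1 by eexists.
have {ex}e1 : nf A1 = fquat u n l x y z 0 by apply: quatP => //=.
have [s [m [b [c e2]]]] : exists s m b c, nf A2 = fquat u n l s m b c.
  exists (nf A2).1, (dot u (nf A2).2), (dot n (nf A2).2), (dot l (nf A2).2).
  by apply: quatP => //=; exact: comb_span.
have e0 : nf A0 = fquat u n l 1 0 0 0.
  by rewrite nf0 /fquat /comb !scale0r !addr0.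
have : mu ^+ 2 *: sandwich u (nf A1) (nf A1) =
    quat_of_vec (vect (mu ^+ 2 *: sandwich u (nf A2) (nf A0))).
  by rewrite -!(sandwich_mulr _ _ s0) !nfK.
rewrite e0 e1 e2 (sandwich_fquat F) (sandwich_fquat1 F) -quat_of_vecZ.
case; rewrite !combZ => /(comb_inj F)[].
move=> /(mulfI mu2) hs /(mulfI mu2) hc /(mulfI mu2) hb.
exists n, l, x, y, z, m; split=> // t t01.
have := vr t t01.
have -> : quat_curve A0 A1 A2 t =
    qmul (quat_curve (nf A0) (nf A1) (nf A2) t) A0.
  by rewrite -quat_curve_qmul !nfK.
rewrite (sandwich_mulr _ _ s0).
have -> : quat_curve (nf A0) (nf A1) (nf A2) t = quat_preimage u n l x y z m t.
  rewrite e0 e1 e2 /quat_preimage.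
  by congr (quat_curve _ _ (fquat _ _ _ _ _ _ _) _); lra.
by rewrite (sandwich_quat_preimage _ _ _ _ _ F) -quat_of_vecZ => -[].
Qed.

End Necessity.

(** * The bound on the angle *)

Section Angle.
Variable R : realType.
Implicit Types (k a b x : R).

Lemma cos_2pi5 : let k := cos (2 * pi / 5 : R) in
  0 < k /\ 4 * k ^+ 2 + 2 * k - 1 = 0.
Proof.
move=> k.
have pi0 : 0 < (pi : R) := pi_gt0 R.
have k0 : 0 < k by apply: cos_gt0_pihalf; lra.
split=> //.
set th : R := 2 * pi / 5 in k k0 *.
have s0 : 0 < sin th by apply: sin_gt0_pi; rewrite /th; lra.
have k1 : k ^+ 2 < 1 by rewrite -(cos2Dsin2 th) ltrDl exprn_gt0.
have c2 : cos (th *+ 2) = 2 * k ^+ 2 - 1 by rewrite cos_mulr2n mulr_natl.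
have s2 : sin (th *+ 2) = 2 * (k * sin th).
  by rewrite sin_mulr2n mulr_natl.
(* 3 th = 2 pi - 2 th, hence cos (3 th) = cos (2 th); as an equation in k this
   is (k - 1) (4 k^2 + 2 k - 1) = 0. *)
have c3 : cos (th *+ 2 + th) = cos (th *+ 2).
  rewrite -[RHS]cosN -[RHS](cosD2pi (- (th *+ 2))); congr cos.
  by rewrite /th; field.
move: c3; rewrite cosD c2 s2 -/k => c3.
have sk : sin th ^+ 2 = 1 - k ^+ 2.
  by rewrite -(cos2Dsin2 th) addrAC subrr add0r.
have : (k - 1) * (4 * k ^+ 2 + 2 * k - 1) = 0.
  have : (2 * k ^+ 2 - 1) * k - 2 * k * sin th ^+ 2 = 2 * k ^+ 2 - 1.
    by rewrite -[RHS]c3; ring.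
  rewrite sk => h; lra.
move/eqP; rewrite mulf_eq0 => /orP[/eqP h|/eqP//].
by exfalso; nra.
Qed.

Lemma cos_4pi5 : cos (4 * pi / 5 : R) = 2 * cos (2 * pi / 5 : R) ^+ 2 - 1.
Proof.
have -> : 4 * pi / 5 = (2 * pi / 5 : R) *+ 2 by field.
by rewrite cos_mulr2n; ring.
Qed.

(** Equality holds at x = rho = k, b = 1 - k^2, where the chord of a planar
    member of the class vanishes.  For 2b > 1 the expression is least at
    x = rho and is then decreasing in b.  If rho <= k, the bound b <= 1 - rho^2
    leaves (1 - 2 rho^2) (1 - 4 rho^2 - 2 rho), a product of nonnegative
    factors; if rho >= k, the bound on rho^2 b gives b <= 1 - k^2 and
    rho b <= k (1 - k^2), hence the value at rho = k.  For 2b <= 1 there is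
    room to spare, and numerical bounds on k suffice. *)
Lemma axis_chord_ge0 k (rho b x : R) : 0 < k -> 4 * k ^+ 2 + 2 * k - 1 = 0 ->
  0 <= rho -> 0 <= b -> rho ^+ 2 + b <= 1 -> x ^+ 2 <= rho ^+ 2 ->
  rho ^+ 2 * b <= k ^+ 2 * (1 - k ^+ 2) ->
  0 <= 2 + rho ^+ 2 - b - 8 * rho ^+ 2 * b + 2 * x * (1 - 2 * b).
Proof.
move=> k0 kE r0 b0 rb xr ab.
have k1 : k < 31 / 100 by nra.
have /andP[xr1 xr2] : - rho <= x <= rho.
  by rewrite -ler_norml -(ler_sqr (normr_ge0 x) r0) real_normK ?num_real.
have [b2|b2] := leP (2 * b) 1.
  have ab' : 8 * rho ^+ 2 * b <= 7 / 10.
    suff : k ^+ 2 * (1 - k ^+ 2) <= 7 / 80 by lra.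
    have k3 : 3 / 10 <= k by nra.
    have kk : k ^+ 2 = (1 - 2 * k) / 4 by lra.
    by rewrite {1 2}kk; lra.
  have : 0 <= (rho + x) * (1 - 2 * b) by apply: mulr_ge0; lra.
  have [r4|r4] := leP 1 (4 * rho).
    have : 0 <= b * (4 * rho - 1) by apply: mulr_ge0; lra.
    by have := sqr_ge0 (rho - 1); lra.
  have : 0 <= (1 - 2 * b) * (1 - 4 * rho) by apply: mulr_ge0; lra.
  have := sqr_ge0 rho; lra.
have : 0 <= (rho - x) * (2 * b - 1) by apply: mulr_ge0; lra.
suff : 0 <= 2 + rho ^+ 2 - b - 8 * rho ^+ 2 * b - 2 * rho * (2 * b - 1) by lra.
have [rk|kr] := leP rho k.
  have h1 : 0 <= (1 - rho ^+ 2 - b) * (1 + 8 * rho ^+ 2 + 4 * rho).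
    by apply: mulr_ge0; [lra | have := sqr_ge0 rho; lra].
  have h2 : 0 <= (1 - 2 * rho ^+ 2) * (1 - 4 * rho ^+ 2 - 2 * rho).
    by apply: mulr_ge0; nra.
  lra.
have bk : b <= 1 - k ^+ 2.
  have k2 : 0 < k ^+ 2 by rewrite exprn_gt0.
  rewrite -(ler_pM2l k2); apply: le_trans ab; apply: ler_wpM2r => //.
  by rewrite ler_sqr ?nnegrE; lra.
have rbk : rho * b <= k * (1 - k ^+ 2).
  rewrite -(ler_pM2l k0) [leRHS]mulrA -expr2; apply: le_trans ab.
  rewrite mulrA expr2; apply: ler_wpM2r => //.
  by apply: ler_wpM2r => //; lra.
have rk2 : k ^+ 2 <= rho ^+ 2 by rewrite ler_sqr ?nnegrE; lra.
have : (1 - 2 * k ^+ 2) * (1 - 4 * k ^+ 2 - 2 * k) = 0.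
  by have -> : 1 - 4 * k ^+ 2 - 2 * k = 0; [lra | rewrite mulr0].
lra.
Qed.

Section Frame.
Variables (u n l : 'rV[R]_3) (x y z m : R).
Hypothesis F : rframe u n l.
Let a := x ^+ 2 + y ^+ 2.
Let b := z ^+ 2.
Hypothesis norm1 : (a + b) ^+ 2 + m ^+ 2 = 1.

(** A2 is a unit quaternion whose coordinates along n and l have square sum 4ab,
    so the component of A2 u A2^* along u is (1 - 4ab) - 4ab. *)
Lemma dot_axis_end_tangent : dot u (end_tangent u n l x y z m) = 1 - 8 * a * b.
Proof.
rewrite -{1}(comb1 u n l) (dot_comb F) /=.
have -> : m ^+ 2 = 1 - (a + b) ^+ 2 by rewrite -norm1; ring.
by rewrite /a /b; ring.
Qed.

(** The two sides differ by a multiple of (a + b)^2 + m^2 - 1. *)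
Lemma chord_balanceE : dot u (chord u n l x y z m) -
    dot (chord u n l x y z m) (end_tangent u n l x y z m) =
  4 * b * (y * m - x * (1 - a - b)).
Proof.
have -> : dot u (chord u n l x y z m) -
       dot (chord u n l x y z m) (end_tangent u n l x y z m) =
    4 * b * (y * m - x * (1 - a - b)) -
    ((a + b) ^+ 2 + m ^+ 2 - 1) * (1 + x + y * m + (a - b) + x * (a - b) +
       m ^+ 2 + (a + b) ^+ 2 + 2 * x * b).
  by rewrite -{1}(comb1 u n l) !(dot_comb F) /a /b; ring.
by rewrite norm1 subrr mul0r subr0.
Qed.

Lemma chord_balanceP : z != 0 ->
  (dot u (chord u n l x y z m) =
    dot (chord u n l x y z m) (end_tangent u n l x y z m)) <->
  (y * m = x * (1 - a - b)).
Proof.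
move=> z0; have b4 : 4 * b != 0 by rewrite mulf_neq0 ?expf_neq0 ?pnatr_eq0.
split=> /eqP; rewrite -subr_eq0 => h; apply/eqP; rewrite -subr_eq0.
  by move: h; rewrite chord_balanceE mulf_eq0 (negbTE b4).
by rewrite chord_balanceE mulf_eq0 h orbT.
Qed.

(** Balance eliminates the product y m from the component of the chord. *)
Lemma dot_axis_chord : y * m = x * (1 - a - b) ->
  dot u (chord u n l x y z m) = 2 + a - b - 8 * a * b + 2 * x * (1 - 2 * b).
Proof.
move=> ym; rewrite -{1}(comb1 u n l) (dot_comb F) ym.
have -> : m ^+ 2 = 1 - (a + b) ^+ 2 by rewrite -norm1; ring.
by rewrite /a /b; ring.
Qed.

End Frame.

(** For the chord direction d, u . d = uf . d = (u + uf) . d / 2, so that the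
    Cauchy-Schwarz inequality gives (u . d)^2 <= |u + uf|^2 / 4 = 1 - 4ab; and
    u . d < 0 forces ab to be large by [axis_chord_ge0]. *)
Lemma RRMF5_I_angle_bound (i u uf : 'rV[R]_3) (mu : R) (r : 'rV[{poly R}]_3)
    (c := curve_point r 1 - curve_point r 0) :
  dot i i = 1 -> dot u u = 1 -> dot uf uf = 1 -> 0 < mu -> RRMF5_I i r ->
  velocity r 0 = mu ^+ 2 *: u -> velocity r 1 = mu ^+ 2 *: uf ->
  cross u uf <> 0 -> dot u c = dot c uf ->
  c != 0 -> cos (4 * pi / 5) < dot u ((enorm c)^-1 *: c).
Proof.
move=> ii uu ff mu0 rr v0 v1 uf0 bal c0.
have [n [l [x [y [z [m [F vr]]]]]]] := RRMF5_I_normal_form ii uu mu0 v0 rr.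
have mu2 : 0 < mu ^+ 2 by rewrite exprn_gt0.
have ufE : uf = end_tangent u n l x y z m.
  apply: (scalerI (lt0r_neq0 mu2)).
  by rewrite -hodograph1 -vr ?lexx ?ler01.
have := chordP F vr; rewrite -/c => cE.
set a := x ^+ 2 + y ^+ 2; set b := z ^+ 2.
have norm1 : (a + b) ^+ 2 + m ^+ 2 = 1.
  have : ((a + b) ^+ 2 + m ^+ 2) ^+ 2 = 1.
    by rewrite -ff ufE (dot_comb F) /a /b; ring.
  move/eqP; rewrite sqrf_eq1 => /orP[/eqP->//|/eqP h].
  by have := sqr_ge0 (a + b); have := sqr_ge0 m; lra.
(* For z = 0 the hodograph keeps the constant direction u. *)
have z0 : z != 0.
  apply/eqP => z0; apply: uf0; rewrite ufE -{1}(comb1 u n l) (cross_comb F) z0.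
  by apply: row3P; rewrite !mxE; ring.
have k5 : 0 < mu ^+ 2 / 5 by rewrite divr_gt0.
have ym : y * m = x * (1 - a - b).
  apply/(chord_balanceP F norm1 z0); apply: (mulfI (lt0r_neq0 k5)).
  rewrite -dotZr -dotZl -cE -ufE; exact: bal.
have a0 : 0 <= a by rewrite addr_ge0 ?sqr_ge0.
have b0 : 0 <= b by rewrite sqr_ge0.
have ec0 := enorm_gt0 c0.
set t := dot u _.
have [k0 kE] := cos_2pi5.
set k := cos _ in k0 kE.
have kk : k ^+ 2 = (1 - 2 * k) / 4 by lra.
rewrite cos_4pi5 -/k.
have [t0|t0] := leP 0 t; first by nra.
have D0 : dot u (chord u n l x y z m) < 0.
  move: t0; rewrite /t dotZr pmulr_rlt0 ?invr_gt0// cE dotZr.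
  by rewrite pmulr_rlt0.
have ab : k ^+ 2 * (1 - k ^+ 2) < a * b.
  rewrite ltNge; apply/negP => ab; move: D0; apply/negP; rewrite -leNgt.
  rewrite (dot_axis_chord F norm1 ym).
  have := @axis_chord_ge0 k (Num.sqrt a) b x k0 kE (sqrtr_ge0 a) b0.
  rewrite sqr_sqrtr// => h; apply: h => //.
  - by have := sqr_ge0 m; nra.
  - by rewrite /a lerDl sqr_ge0.
have t2 : t ^+ 2 <= 1 - 4 * a * b.
  have := dot_cauchy (u + uf) ((enorm c)^-1 *: c).
  have -> : dot (u + uf) ((enorm c)^-1 *: c) = 2 * t.
    by rewrite dotDl [dot uf _]dotC dotZl -bal -dotZr -/t; ring.
  have -> : dot ((enorm c)^-1 *: c) ((enorm c)^-1 *: c) = 1.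
    by rewrite dotZl dotZr -sqr_enorm; field; rewrite lt0r_neq0.
  have -> : dot (u + uf) (u + uf) = 4 - 16 * a * b.
    have := dot_axis_end_tangent F norm1; rewrite -ufE -/a -/b => e.
    by rewrite dotDl !dotDr uu ff (dotC uf u) e; ring.
  lra.
nra.
Qed.

End Angle.

(** * Frames obtained by rotation along a quaternion polynomial *)

Section Deriv.
Local Open Scope classical_set_scope.
Variable R : realType.
Implicit Types (u v w n l : 'rV[R]_3).

Lemma cvg_sub_dnbhs (t : R) : (s - t) @[s --> t^'] --> (0 : R)^'.
Proof.
move=> A [e /= e0 eA]; exists e => //= s /= se st.
apply: eA; first by rewrite /= sub0r normrN distrC.
by rewrite subr_eq0.
Qed.

(** The derivative as a limit of (f s - f t) / (s - t) at s tending to t, the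
    form that a restriction to an interval preserves. *)
Lemma is_derive_quotient (f : R -> R) (t d : R) : is_derive t (1 : R) f d ->
  (s - t)^-1 * (f s - f t) @[s --> t^'] --> d.
Proof.
case=> df <-.
have h : h^-1 *: (f (h *: 1 + t) - f t) @[h --> (0 : R)^'] --> 'D_1 f t.
  exact: df.
have := cvg_comp _ _ (@cvg_sub_dnbhs t) h.
apply: cvg_trans; apply: near_eq_cvg; apply: nearW => s /=.
by rewrite /GRing.scale/= mulr1 subrK.
Qed.

Lemma is_deriv01_comb u n l (c1 c2 c3 : R -> R) (t d1 d2 d3 : R) :
  is_derive t (1 : R) c1 d1 -> is_derive t (1 : R) c2 d2 ->
  is_derive t (1 : R) c3 d3 ->
  is_deriv01 (fun s => comb u n l (c1 s) (c2 s) (c3 s)) t (comb u n l d1 d2 d3).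
Proof.
move=> /is_derive_quotient h1 /is_derive_quotient h2 /is_derive_quotient h3.
apply: cvg_within_filter.
have -> : (fun s => (s - t)^-1 *: (comb u n l (c1 s) (c2 s) (c3 s) -
    comb u n l (c1 t) (c2 t) (c3 t))) =
  (fun s => ((s - t)^-1 * (c1 s - c1 t)) *: u +
            ((s - t)^-1 * (c2 s - c2 t)) *: n +
            ((s - t)^-1 * (c3 s - c3 t)) *: l).
  by apply/funext => s; rewrite combN combD combZ.
by apply: cvgD; [apply: cvgD|]; apply: cvgZr_tmp.
Qed.

Lemma is_derive_ratio (p q : {poly R}) (t : R) : q.[t] != 0 ->
  is_derive t (1 : R) (fun s => p.[s] / q.[s])
    ((p^`().[t] * q.[t] - p.[t] * q^`().[t]) / q.[t] ^+ 2).
Proof.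
move=> q0.
have dq := is_derive_poly q t.
have dV : is_derive t (1 : R) (fun s => (q.[s])^-1)
    (- q.[t] ^- 2 *: q^`().[t]).
  apply: DeriveDef; first exact: derivableV.
  by rewrite deriveV// derive_val.
have dM := is_deriveM (is_derive_poly p t) dV.
apply: (is_derive_eq dM).
by rewrite /GRing.scale/=; field.
Qed.


Section RotationField.
Variables (u n l : 'rV[R]_3) (F0 F1 F2 F3 : {poly R}).
Hypothesis F : rframe u n l.

Definition sqnorm : {poly R} := F0 * F0 + F1 * F1 + F2 * F2 + F3 * F3.

(** The coordinates in (u, n, l) of F v F^*, where F = F0 + F1 u + F2 n + F3 l
    and v = a u + b n + c l. *)
Definition rot1 (a b c : R) : {poly R} :=
  a *: (F0 * F0 + F1 * F1 - F2 * F2 - F3 * F3) +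
  (2 * b) *: (F1 * F2 - F0 * F3) + (2 * c) *: (F1 * F3 + F0 * F2).
Definition rot2 (a b c : R) : {poly R} :=
  (2 * a) *: (F1 * F2 + F0 * F3) +
  b *: (F0 * F0 - F1 * F1 + F2 * F2 - F3 * F3) + (2 * c) *: (F2 * F3 - F0 * F1).
Definition rot3 (a b c : R) : {poly R} :=
  (2 * a) *: (F1 * F3 - F0 * F2) + (2 * b) *: (F2 * F3 + F0 * F1) +
  c *: (F0 * F0 - F1 * F1 - F2 * F2 + F3 * F3).

Definition rotated (v : 'rV[R]_3) (t : R) : 'rV[R]_3 :=
  let a := dot u v in let b := dot n v in let c := dot l v in
  comb u n l ((rot1 a b c).[t] / sqnorm.[t]) ((rot2 a b c).[t] / sqnorm.[t])
    ((rot3 a b c).[t] / sqnorm.[t]).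

(** The scalar part of F u F'^*, proportional to the angular velocity of the
    rotating frame about the image of u. *)
Definition twist (t : R) : R :=
  F0.[t] * F1^`().[t] - F1.[t] * F0^`().[t] -
  F2.[t] * F3^`().[t] + F3.[t] * F2^`().[t].

Let hE := (hornerD, hornerN, hornerM, hornerZ).
Let dE := (derivD, derivN, derivM, derivZ, hornerD, hornerN, hornerM, hornerZ).

Lemma sqnormE t : sqnorm.[t] =
  F0.[t] ^+ 2 + F1.[t] ^+ 2 + F2.[t] ^+ 2 + F3.[t] ^+ 2.
Proof. by rewrite /sqnorm !hE -!expr2. Qed.
Lemma rot1E a b c t : (rot1 a b c).[t] =
  a * (F0.[t] ^+ 2 + F1.[t] ^+ 2 - F2.[t] ^+ 2 - F3.[t] ^+ 2) +
  2 * b * (F1.[t] * F2.[t] - F0.[t] * F3.[t]) +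
  2 * c * (F1.[t] * F3.[t] + F0.[t] * F2.[t]).
Proof. by rewrite /rot1 !hE -!expr2. Qed.
Lemma rot2E a b c t : (rot2 a b c).[t] =
  2 * a * (F1.[t] * F2.[t] + F0.[t] * F3.[t]) +
  b * (F0.[t] ^+ 2 - F1.[t] ^+ 2 + F2.[t] ^+ 2 - F3.[t] ^+ 2) +
  2 * c * (F2.[t] * F3.[t] - F0.[t] * F1.[t]).
Proof. by rewrite /rot2 !hE -!expr2. Qed.
Lemma rot3E a b c t : (rot3 a b c).[t] =
  2 * a * (F1.[t] * F3.[t] - F0.[t] * F2.[t]) +
  2 * b * (F2.[t] * F3.[t] + F0.[t] * F1.[t]) +
  c * (F0.[t] ^+ 2 - F1.[t] ^+ 2 - F2.[t] ^+ 2 + F3.[t] ^+ 2).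
Proof. by rewrite /rot3 !hE -!expr2. Qed.

Lemma dot_rotated v w t : sqnorm.[t] != 0 ->
  dot (rotated v t) (rotated w t) = dot v w.
Proof.
move=> s0; rewrite [in RHS](comb_span F v) [in RHS](comb_span F w).
rewrite !(dot_comb F); move: s0; rewrite !rot1E !rot2E !rot3E !sqnormE => s0.
by field.
Qed.

Lemma rational_rotated v : (forall t, 0 <= t <= 1 -> sqnorm.[t] != 0) ->
  rational01 (rotated v).
Proof.
move=> s0 k; set a := dot u v; set b := dot n v; set c := dot l v.
exists (u 0 k *: rot1 a b c + n 0 k *: rot2 a b c + l 0 k *: rot3 a b c).
exists sqnorm.
move=> t /s0 st; split=> //.
rewrite /rotated /comb !mxE -/a -/b -/c.
move: (rot1 _ _ _) (rot2 _ _ _) (rot3 _ _ _) => p1 p2 p3.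
by move: (sqnorm.[t]) st => q q0; rewrite !hE; field.
Qed.

(** In the moving frame the angular velocity is 2 F^* F' / |F|^2, with
    coordinates proportional to (twist, tw2, tw3), and the derivative of an
    image vector is its cross product with the angular velocity.  For v normal
    to u and vanishing twist, the cross product (0, tw2, tw3) x (0, b, c) lies
    along the first axis. *)
Lemma deriv_rotated v t : sqnorm.[t] != 0 -> twist t = 0 -> dot u v = 0 ->
  exists k, is_deriv01 (rotated v) t (k *: rotated u t).
Proof.
move=> s0 tw uv.
have [uu nu lu] : [/\ dot u u = 1, dot n u = 0 & dot l u = 0].
  by case: F => uu _ un ->; rewrite uu (dotC n) un (dotC _ u) dot_crossl.
pose b := dot n v; pose c := dot l v.
pose tw2 := F0.[t] * F2^`().[t] - F2.[t] * F0^`().[t] -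
            F3.[t] * F1^`().[t] + F1.[t] * F3^`().[t].
pose tw3 := F0.[t] * F3^`().[t] - F3.[t] * F0^`().[t] -
            F1.[t] * F2^`().[t] + F2.[t] * F1^`().[t].
pose k := 2 * (c * tw2 - b * tw3) / sqnorm.[t].
exists k; rewrite /rotated uv uu nu lu -/b -/c combZ.
have e1 : (rot1 0 b c)^`().[t] * sqnorm.[t] -
    (rot1 0 b c).[t] * sqnorm^`().[t] =
    2 * (c * tw2 - b * tw3) * (rot1 1 0 0).[t] +
    2 * twist t * (b * (rot1 0 0 1).[t] - c * (rot1 0 1 0).[t]).
  by rewrite /twist /tw2 /tw3 /rot1 /sqnorm !dE; ring.
have e2 : (rot2 0 b c)^`().[t] * sqnorm.[t] -
    (rot2 0 b c).[t] * sqnorm^`().[t] =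
    2 * (c * tw2 - b * tw3) * (rot2 1 0 0).[t] +
    2 * twist t * (b * (rot2 0 0 1).[t] - c * (rot2 0 1 0).[t]).
  by rewrite /twist /tw2 /tw3 /rot2 /sqnorm !dE; ring.
have e3 : (rot3 0 b c)^`().[t] * sqnorm.[t] -
    (rot3 0 b c).[t] * sqnorm^`().[t] =
    2 * (c * tw2 - b * tw3) * (rot3 1 0 0).[t] +
    2 * twist t * (b * (rot3 0 0 1).[t] - c * (rot3 0 1 0).[t]).
  by rewrite /twist /tw2 /tw3 /rot3 /sqnorm !dE; ring.
have tr (p q : {poly R}) (g : R) :
    p^`().[t] * sqnorm.[t] - p.[t] * sqnorm^`().[t] =
      2 * (c * tw2 - b * tw3) * q.[t] + 2 * twist t * g ->
    is_derive t (1 : R) (fun s => p.[s] / sqnorm.[s])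
      (k * (q.[t] / sqnorm.[t])).
  move=> e; apply: (is_derive_eq (is_derive_ratio p s0)); rewrite e tw.
  by rewrite /k; field.
by apply: is_deriv01_comb; apply: tr; [exact: e1|exact: e2|exact: e3].
Qed.

End RotationField.

(** The left-hand side is the twist of Q (w0 - w1 u), where w0 - w1 u commutes
    with u, so that its rotation about u is subtracted from that of Q. *)
Lemma twist_untwist (q0 q1 q2 q3 w0 w1 : {poly R}) t :
  twist (q0 * w0 + q1 * w1) (q1 * w0 - q0 * w1) (q2 * w0 - q3 * w1)
    (q3 * w0 + q2 * w1) t =
  (w0.[t] ^+ 2 + w1.[t] ^+ 2) * twist q0 q1 q2 q3 t -
  (q0.[t] ^+ 2 + q1.[t] ^+ 2 + q2.[t] ^+ 2 + q3.[t] ^+ 2) *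
  (w0.[t] * w1^`().[t] - w1.[t] * w0^`().[t]).
Proof.
by rewrite /twist !(derivD, derivN, derivM, hornerD, hornerN, hornerM); ring.
Qed.

End Deriv.

(** * The rational rotation-minimizing frame of a normal form *)

Section RMF.
Variable R : realType.
Implicit Types (v w : 'rV[R]_3).

(** The real part of the quadratic W = untwist + pre1 u with Bernstein
    coefficients 1, x + y u and (x^2 + y^2 + z^2) + m u; it shares its
    u-component with the preimage. *)
Definition untwist (x y z : R) : {poly R} :=
  (1 - 'X) ^+ 2 + (2 * x) *: ('X * (1 - 'X)) +
  (x ^+ 2 + y ^+ 2 + z ^+ 2) *: 'X ^+ 2.

Lemma untwistE x y z t : (untwist x y z).[t] =
  (1 - t) ^+ 2 + 2 * x * (t * (1 - t)) + (x ^+ 2 + y ^+ 2 + z ^+ 2) * t ^+ 2.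
Proof. by rewrite /untwist !hornerE. Qed.

Section NormalForm.
Variables (u n l : 'rV[R]_3) (x y z m : R).
Hypothesis F : rframe u n l.
Hypothesis z0 : z != 0.

Let q0 := pre0 x y z.
Let q1 := pre1 y m.
Let q2 := pre2 x z.
Let q3 := pre3 y z.
Let w0 := untwist x y z.

Definition rmf0 := q0 * w0 + q1 * q1.
Definition rmf1 := q1 * w0 - q0 * q1.
Definition rmf2 := q2 * w0 - q3 * q1.
Definition rmf3 := q3 * w0 + q2 * q1.

Lemma rmf0E t : rmf0.[t] = q0.[t] * w0.[t] + q1.[t] ^+ 2.
Proof. by rewrite /rmf0 hornerD !hornerM -expr2. Qed.
Lemma rmf1E t : rmf1.[t] = q1.[t] * w0.[t] - q0.[t] * q1.[t].
Proof. by rewrite /rmf1 hornerD hornerN !hornerM. Qed.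
Lemma rmf2E t : rmf2.[t] = q2.[t] * w0.[t] - q3.[t] * q1.[t].
Proof. by rewrite /rmf2 hornerD hornerN !hornerM. Qed.
Lemma rmf3E t : rmf3.[t] = q3.[t] * w0.[t] + q2.[t] * q1.[t].
Proof. by rewrite /rmf3 hornerD !hornerM. Qed.

Let speed t := w0.[t] ^+ 2 + q1.[t] ^+ 2.

Lemma speedE t :
  speed t = q0.[t] ^+ 2 + q1.[t] ^+ 2 + q2.[t] ^+ 2 + q3.[t] ^+ 2.
Proof.
by rewrite /speed /q0 /q1 /q2 /q3 /w0 pre0E pre1E pre2E pre3E untwistE; ring.
Qed.

(** Where the preimage A vanishes so does W, as |W| = |A|; the real parts differ
    by 2 (z t)^2, which forces t = 0, but A = 1 there. *)
Lemma speed_gt0 t : 0 < speed t.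
Proof.
have := speedE t; rewrite {1}/speed => e.
have := sqr_ge0 w0.[t]; have := sqr_ge0 q0.[t]; have := sqr_ge0 q1.[t].
have := sqr_ge0 q2.[t]; have := sqr_ge0 q3.[t] => h3 h2 h1 h0 hw.
rewrite lt_neqAle addr_ge0// andbT eq_sym; apply/eqP => s0.
have sq0 (a : R) : a ^+ 2 = 0 -> a = 0 by move/eqP; rewrite sqrf_eq0 => /eqP.
have e0 : q0.[t] = 0 by apply: sq0; rewrite /speed in s0; lra.
have ew : w0.[t] = 0 by apply: sq0; rewrite /speed in s0; lra.
have zt : (z * t) ^+ 2 = 0.
  by move: e0 ew; rewrite /q0 /w0 pre0E untwistE => e0 ew; lra.
have t0 : t = 0 by move/eqP: zt; rewrite sqrf_eq0 mulf_eq0 (negbTE z0) => /eqP.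
by move: e0; rewrite t0 /q0 pre0E; lra.
Qed.

Lemma sqnorm_rmf t : (sqnorm rmf0 rmf1 rmf2 rmf3).[t] = speed t ^+ 2.
Proof.
by rewrite expr2 {2}speedE /speed sqnormE rmf0E rmf1E rmf2E rmf3E; ring.
Qed.

(** Since |W|^2 = |A|^2, [twist_untwist] leaves |A|^2 times the difference of
    the twists of A and of W, two polynomials that agree by the choice of the
    coefficients of W. *)
Lemma twist_rmf t : twist rmf0 rmf1 rmf2 rmf3 t = 0.
Proof.
set d := fun p : {poly R} => p^`().[t].
have dE : [/\ d q0 = - 2 * (1 - t) + 2 * x * (1 - 2 * t) +
                     2 * (x ^+ 2 + y ^+ 2 - z ^+ 2) * t,
    d q1 = 2 * y * (1 - 2 * t) + 2 * m * t,
    d q2 = 2 * z * (1 - 2 * t) + 4 * x * z * t,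
    d q3 = 4 * y * z * t &
    d w0 = - 2 * (1 - t) + 2 * x * (1 - 2 * t) +
                     2 * (x ^+ 2 + y ^+ 2 + z ^+ 2) * t].
  rewrite /d /q0 /q1 /q2 /q3 /w0 /pre0 /pre1 /pre2 /pre3 /untwist !expr2.
  split; rewrite !(derivD, derivN, derivZ, derivM, derivX, derivC,
    hornerD, hornerN, hornerZ, hornerM, hornerX, hornerC); ring.
rewrite twist_untwist -/(speed t) -speedE -mulrBr /twist.
rewrite -!/(d _).
case: dE => -> -> -> -> ->; rewrite /q0 /q1 /q2 /q3 /w0.
rewrite pre0E pre1E pre2E pre3E untwistE.
by apply/eqP; rewrite mulf_eq0; apply/orP; right; apply/eqP; ring.
Qed.

Definition rmf_field v := rotated u n l rmf0 rmf1 rmf2 rmf3 v.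

Lemma rmf_field0 v : rmf_field v 0 = v.
Proof.
rewrite /rmf_field /rotated [RHS](comb_span F) rot1E rot2E rot3E sqnormE.
have [-> -> -> ->] :
    [/\ rmf0.[0] = 1, rmf1.[0] = 0, rmf2.[0] = 0 & rmf3.[0] = 0].
  rewrite rmf0E rmf1E rmf2E rmf3E.
  rewrite /q0 /q1 /q2 /q3 /w0 pre0E pre1E pre2E pre3E untwistE.
  by split; ring.
by congr comb; field.
Qed.

Lemma dot_hodograph t : dot (hodograph u n l x y z m t)
  (hodograph u n l x y z m t) = speed t ^+ 2.
Proof. by rewrite /hodograph (dot_comb F) speedE /q0 /q1 /q2 /q3; ring. Qed.

(** W^* commutes with u, so F u F^* = |W|^2 A u A^*. *)
Lemma rmf_field_tangent t :
  rmf_field u t = (speed t)^-1 *: hodograph u n l x y z m t.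
Proof.
have [uu nu lu] : [/\ dot u u = 1, dot n u = 0 & dot l u = 0].
  by case: F => uu _ un ->; rewrite uu (dotC n) un (dotC _ u) dot_crossl.
have s0 : speed t != 0 by rewrite gt_eqF// speed_gt0.
rewrite /rmf_field /rotated uu nu lu sqnorm_rmf /hodograph combZ.
rewrite rot1E rot2E rot3E rmf0E rmf1E rmf2E rmf3E -/q0 -/q1 -/q2 -/q3.
by congr comb; rewrite /speed in s0 *; field.
Qed.

Lemma rmf_field_rational_RMF (r : 'rV[{poly R}]_3) k v w :
  0 < k -> (forall t, velocity r t = k *: hodograph u n l x y z m t) ->
  orthonormal3 u v w ->
  rational_RMF r (rmf_field u) (rmf_field v) (rmf_field w).
Proof.
move=> k0 vr [[/enorm1P uu /enorm1P vv /enorm1P ww] [uv vw uw]].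
have s0 t : (sqnorm rmf0 rmf1 rmf2 rmf3).[t] != 0.
  by rewrite sqnorm_rmf expf_neq0// gt_eqF// speed_gt0.
split.
- move=> t _; split.
    by split; split; rewrite ?enorm1P /rmf_field dot_rotated.
  rewrite rmf_field_tangent vr enormZ ?ltW// /enorm dot_hodograph.
  rewrite sqrtr_sqr ger0_norm ?ltW ?speed_gt0// scalerA invfM mulrAC.
  by rewrite mulVf ?mul1r// gt_eqF.
- by move=> t _; split; apply: deriv_rotated => //; exact: twist_rmf.
- by split; apply: rational_rotated => // t _; exact: s0.
Qed.

End NormalForm.

End RMF.

(** * Construction of interpolants *)

Section Existence.
Variable R : realType.
Implicit Types (i u v w n l d : 'rV[R]_3) (A B C : quat R).

Definition primitive (p : {poly R}) : {poly R} :=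
  \poly_(j < (size p).+1) (p`_j.-1 / j%:R).

Lemma deriv_primitive p : (primitive p)^`() = p.
Proof.
apply/polyP => j; rewrite coef_deriv coef_poly ltnS.
case: ltnP => [_|jp]; last by rewrite mul0rn nth_default.
by rewrite -[LHS]mulr_natr divfK ?pnatr_eq0.
Qed.

(* The coefficient 0^-1 of the constant term is 0. *)
Lemma primitive0 p : (primitive p).[0] = 0.
Proof. by rewrite horner_coef0 coef_poly/= invr0 mulr0. Qed.

(** A half-turn about h: for a pure vector h, h i h^* = 2 (h . i) h - |h|^2 i.
    Take h along the bisector i + u, or normal to i when u = - i. *)
Lemma ex_rotation i u : dot i i = 1 -> dot u u = 1 ->
  exists C, sandwich i C C = quat_of_vec u.
Proof.
move=> ii uu.
have [h hE] : exists h, (2 * dot h i) *: h - dot h h *: i = u.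
  have [e|e] := eqVneq (i + u) 0.
    have [h hh ih] := ex_unit_perp i; exists h.
    rewrite dotC ih mulr0 scale0r hh scale1r sub0r.
    by apply/eqP; rewrite eq_sym -addr_eq0 addrC e.
  have e0 := dotvv_gt0 e.
  pose k := (enorm (i + u))^-1; exists (k *: (i + u)).
  have k2 : k ^+ 2 * (2 + 2 * dot i u) = 1.
    have -> : 2 + 2 * dot i u = dot (i + u) (i + u).
      by rewrite dotDl !dotDr ii uu (dotC u i); ring.
    by rewrite /k exprVn sqr_enorm mulVf// gt_eqF.
  have -> : dot (k *: (i + u)) (k *: (i + u)) = 1.
    by rewrite dotZl dotZr dotDl !dotDr ii uu (dotC u i) -[RHS]k2; ring.
  have -> : 2 * dot (k *: (i + u)) i = k * (2 + 2 * dot i u).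
    by rewrite dotZl dotDl ii (dotC u i); ring.
  rewrite scalerA mulrAC -expr2 k2 !scale1r.
  by rewrite addrC addKr.
exists (0, h); rewrite -hE; apply: quatP.
  by rewrite /=/scal/vect/= !(cross0E, cross1E, cross2E, mxE, dotE); ring.
apply: row3P; rewrite /=/scal/vect/=.
all: by rewrite !(cross0E, cross1E, cross2E, mxE, dotE); ring.
Qed.

(** The frame can be turned about u, so only the component c along u and the
    distance from the axis matter.  With g = d - c u, the vector n solves
    e n + f (u x n) = g. *)
Lemma ex_rframe_comb u d (c e f : R) : dot u u = 1 -> dot d d = 1 ->
  c = dot u d -> e ^+ 2 + f ^+ 2 = 1 - c ^+ 2 -> c ^+ 2 != 1 ->
  exists n l, rframe u n l /\ d = comb u n l c e f.
Proof.
move=> uu dd cE ef c1.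
pose s2 := 1 - c ^+ 2.
have s0 : s2 != 0 by rewrite subr_eq0 eq_sym.
pose g := d - c *: u.
have ug : dot u g = 0 by rewrite dotDr -scaleNr dotZr uu -cE; ring.
have gg : dot g g = s2.
  rewrite /g dotDl !dotDr -!scaleNr !dotZl !dotZr dd uu (dotC d u) -cE /s2.
  by ring.
have ugg : cross u (cross u g) = - g.
  by rewrite cross_cross ug uu scale0r scale1r sub0r.
pose n := s2^-1 *: (e *: g - f *: cross u g).
exists n, (cross u n); split.
  split=> //.
    have gu : dot g (cross u g) = 0 by rewrite dot_crossr.
    rewrite dotZl dotZr dotDl !dotDr -!scaleNr !dotZl !dotZr (dotC (cross u g)).
    rewrite gu dot_cross_cross uu ug gg.
    have s2E : s2 = e ^+ 2 + f ^+ 2 by rewrite ef.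
    by rewrite s2E in s0 *; field.
  by rewrite dotZr dotDr -!scaleNr !dotZr ug dot_crossl; ring.
have -> : cross u n = s2^-1 *: (e *: cross u g + f *: g).
  by rewrite crossZr crossDr -!scaleNr !crossZr ugg scalerN scaleNr opprK.
have -> : d = c *: u + g by rewrite addrC subrK.
rewrite /comb -addrA; congr (_ + _).
have s2E : s2 = e ^+ 2 + f ^+ 2 by rewrite ef.
rewrite /n s2E; move: g (cross u g) {ug gg ugg n} => g1 g2; rewrite s2E in s0.
by apply: row3P; rewrite !mxE; field.
Qed.

Definition hodo_poly u n l (x y z m : R) : 'rV[{poly R}]_3 :=
  let q0 := pre0 x y z in let q1 := pre1 y m in
  let q2 := pre2 x z in let q3 := pre3 y z in
  \row_k (u 0 k *: (q0 * q0 + q1 * q1 - q2 * q2 - q3 * q3) +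
          n 0 k *: (2 *: (q1 * q2 + q0 * q3)) +
          l 0 k *: (2 *: (q1 * q3 - q0 * q2))).

Lemma hodo_polyE u n l x y z m t k :
  (hodo_poly u n l x y z m 0 k).[t] = hodograph u n l x y z m t 0 k.
Proof.
rewrite /hodo_poly /hodograph /comb !mxE.
move: (pre0 _ _ _) (pre1 _ _) (pre2 _ _) (pre3 _ _) => q0 q1 q2 q3.
by rewrite !(hornerD, hornerN, hornerZ, hornerM); ring.
Qed.

Lemma ex_curve u n l x y z m k (p : 'rV[R]_3) : exists r : 'rV[{poly R}]_3,
  curve_point r 0 = p /\
  forall t, velocity r t = k *: hodograph u n l x y z m t.
Proof.
have [h hE] : exists h : 'rV[{poly R}]_3,
    forall t j, (h 0 j).[t] = hodograph u n l x y z m t 0 j.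
  by exists (hodo_poly u n l x y z m) => t j; exact: hodo_polyE.
exists (\row_j ((p 0 j)%:P + primitive (k *: h 0 j))).
split=> [|t]; apply/rowP => j.
  by rewrite !mxE hornerD hornerC primitive0 addr0.
rewrite [RHS]mxE -hE !mxE.
by rewrite derivD derivC add0r deriv_primitive hornerZ.
Qed.

(** The normal form has axis u; multiplying its coefficients on the right by a
    quaternion that rotates i to u restores the axis i. *)
Lemma RRMF5_I_of_hodograph i u n l x y z m (mu : R) (r : 'rV[{poly R}]_3) :
  dot i i = 1 -> rframe u n l ->
  (forall t, velocity r t = mu ^+ 2 *: hodograph u n l x y z m t) ->
  RRMF5_I i r.
Proof.
move=> ii F vr; have uu : dot u u = 1 by case: F.
have [C0 sC0] := ex_rotation ii uu.
pose C := mu *: C0.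
have sC : sandwich i C C = quat_of_vec (mu ^+ 2 *: u).
  have -> : sandwich i C C = mu ^+ 2 *: sandwich i C0 C0.
    rewrite /sandwich /C.
    have -> : qconj (mu *: C0) = mu *: qconj C0.
      by apply: quatP; rewrite /= ?scalerN.
    by rewrite !(qmulZl, qmulZr) scalerA expr2.
  by rewrite sC0 -quat_of_vecZ.
exists (qmul (fquat u n l 1 0 0 0) C), (qmul (fquat u n l x y z 0) C),
  (qmul (fquat u n l (x ^+ 2 + y ^+ 2 - z ^+ 2) m (2 * x * z) (2 * y * z)) C).
split=> [t _|].
  rewrite quat_curve_qmul (sandwich_mulr _ _ sC).
  by rewrite (sandwich_quat_preimage _ _ _ _ _ F) -quat_of_vecZ vr.
rewrite !(sandwich_mulr _ _ sC) (sandwich_fquat F) (sandwich_fquat1 F).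
rewrite -quat_of_vecZ; congr quat_of_vec; rewrite /vect /= !combZ.
by congr comb; ring.
Qed.

(** A normal form of unit final tangent with chord L d has displacement
    (mu^2 / 5) L d, which is the prescribed one for mu^2 = 5 |pe - ps| / L.  The
    condition 4ab <> 1, together with a, b <> 0, keeps the tangents from being
    parallel, since |u x uf|^2 = 16 ab (1 - 4ab). *)
Lemma RRMF5_I_interpolant i u v w n l x y z m (L : R) (ps pe : 'rV[R]_3)
    (d := (enorm (pe - ps))^-1 *: (pe - ps))
    (a := x ^+ 2 + y ^+ 2) (b := z ^+ 2) :
  dot i i = 1 -> orthonormal3 u v w -> rframe u n l -> pe - ps != 0 ->
  (a + b) ^+ 2 + m ^+ 2 = 1 -> y * m = x * (1 - a - b) ->
  a != 0 -> z != 0 -> 4 * a * b != 1 ->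
  0 < L -> chord u n l x y z m = L *: d ->
  exists uf, [/\ enorm uf = 1, cross u uf <> 0, dot u d = dot d uf &
    exists (r : 'rV[{poly R}]_3) (f1 f2 f3 : R -> 'rV[R]_3) (mu : R),
      RRMF5_I i r /\ rational_RMF r f1 f2 f3 /\ 0 < mu /\
      curve_point r 0 = ps /\ curve_point r 1 = pe /\
      f1 0 = u /\ f2 0 = v /\ f3 0 = w /\
      velocity r 0 = mu ^+ 2 *: u /\ velocity r 1 = mu ^+ 2 *: uf].
Proof.
move=> ii uvw F p0 norm1 ym a0 z0 ab1 L0 chE.
have uu : dot u u = 1 by case: F.
have e0 := enorm_gt0 p0.
have hh : dot (end_tangent u n l x y z m) (end_tangent u n l x y z m) = 1.
  transitivity (((a + b) ^+ 2 + m ^+ 2) ^+ 2); last by rewrite norm1 expr1n.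
  by rewrite (dot_comb F) /a /b; ring.
exists (end_tangent u n l x y z m); split; first exact/enorm1P.
- move=> h; have := dot_cross_cross u (end_tangent u n l x y z m).
  rewrite h (dot_axis_end_tangent F norm1) hh uu -/a -/b.
  have -> : dot (0 : 'rV[R]_3) 0 = 0 by rewrite dotE !mxE; ring.
  move=> /eqP; rewrite eq_sym.
  have -> : 1 * 1 - (1 - 8 * a * b) ^+ 2 = 16 * (a * b * (1 - 4 * a * b)).
    by ring.
  rewrite !mulf_eq0 (negbTE a0) (negbTE z0) !pnatr_eq0/=.
  by rewrite subr_eq0 eq_sym (negbTE ab1).
- apply: (mulfI (lt0r_neq0 L0)); rewrite -dotZr -dotZl -chE.
  exact/(chord_balanceP F norm1 z0).
pose k := 5 * enorm (pe - ps) / L.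
have k0 : 0 < k by rewrite divr_gt0// mulr_gt0.
have k2 : Num.sqrt k ^+ 2 = k by rewrite sqr_sqrtr// ltW.
have [r [r0 vr]] := ex_curve u n l x y z m k ps.
exists r, (rmf_field u n l x y z m u), (rmf_field u n l x y z m v),
  (rmf_field u n l x y z m w), (Num.sqrt k).
rewrite k2 sqrtr_gt0 !(rmf_field0 _ _ _ _ F) !vr hodograph0 hodograph1.
split.
  by apply: (RRMF5_I_of_hodograph (mu := Num.sqrt k) ii F) => t; rewrite k2 vr.
split; first exact: (rmf_field_rational_RMF F z0 k0 vr uvw).
split=> //; split=> //; split=> //.
have := chordP F (fun t _ => vr t).
rewrite r0 chE !scalerA /k => h.
rewrite -(subrK ps pe); apply/eqP; rewrite -subr_eq h.
apply/eqP; rewrite -[RHS]scale1r; congr (_ *: _); field.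
by rewrite !gt_eqF.
Qed.

(** For c <> 0 the planar solution x = cos(tau/2), z = sin(tau/2) serves, with
    tau = acos c, so that c = 2x^2 - 1; the chord is 4x^2 + 2x - 1 times a unit
    vector, and this factor is positive as x > k = cos(2 pi/5). *)
Lemma ex_normal_form_chord (c : R) : cos (4 * pi / 5) < c -> c < 1 ->
  exists (x y z m L e f : R) (a := x ^+ 2 + y ^+ 2) (b := z ^+ 2),
  [/\ (a + b) ^+ 2 + m ^+ 2 = 1, y * m = x * (1 - a - b), a != 0, z != 0 &
      4 * a * b != 1] /\
  [/\ 0 < L, e ^+ 2 + f ^+ 2 = 1 - c ^+ 2 &
      forall u n l, chord u n l x y z m = L *: comb u n l c e f].
Proof.
rewrite cos_4pi5 => ck c1; have [k0 kE] := cos_2pi5 R.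
set k := cos _ in ck k0 kE.
have cN1 : -1 < c by have := sqr_ge0 k; lra.
have [c0|c0] := eqVneq c 0.
  (* The planar solution has 4ab = 1 here.  The rational point a = 10/17,
     b = 2/5, x = -13/17 solves the balance condition 2x^2 = a (1 + a + b) and
     2 + a - b - 8ab + 2x (1 - 2b) = 0, so that the chord is normal to u;
     y = -1/17 and m = 13/85 follow from x^2 + y^2 = a and
     (a + b)^2 + m^2 = 1.  E z and F z are the other components of the chord. *)
  pose z := Num.sqrt (2 / 5 : R).
  have z2 : z ^+ 2 = 2 / 5 by rewrite sqr_sqrtr.
  pose E : R := - 429 / 1445; pose F : R := - 407 / 1445.
  pose L := Num.sqrt ((E ^+ 2 + F ^+ 2) * z ^+ 2).
  have EF : 0 < (E ^+ 2 + F ^+ 2) * z ^+ 2 by rewrite z2 /E /F; lra.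
  have L2 : L ^+ 2 = (E ^+ 2 + F ^+ 2) * z ^+ 2 by rewrite sqr_sqrtr// ltW.
  have L0 : 0 < L by rewrite sqrtr_gt0.
  have Ln : L != 0 by rewrite gt_eqF.
  exists (- 13 / 17), (- 1 / 17), z, (13 / 85), L, (E * z / L), (F * z / L).
  split; split; rewrite ?z2//.
  - by field.
  - by field.
  - by apply: lt0r_neq0; lra.
  - by rewrite gt_eqF// sqrtr_gt0.
  - by rewrite lt_eqF//; lra.
  - have -> : (E * z / L) ^+ 2 + (F * z / L) ^+ 2 =
        (E ^+ 2 + F ^+ 2) * z ^+ 2 / L ^+ 2 by field.
    by rewrite L2 divff ?gt_eqF// c0 expr0n subr0.
  move=> u n l; rewrite combZ c0 /chord z2.
  by congr comb; rewrite /E /F; field.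
pose x := Num.sqrt ((1 + c) / 2); pose z := Num.sqrt ((1 - c) / 2).
have x2 : x ^+ 2 = (1 + c) / 2 by rewrite sqr_sqrtr//; lra.
have z2 : z ^+ 2 = (1 - c) / 2 by rewrite sqr_sqrtr//; lra.
have x0 : 0 < x by rewrite sqrtr_gt0; lra.
have z0 : 0 < z by rewrite sqrtr_gt0; lra.
have kx : k < x.
  by rewrite -ltr_sqr ?nnegrE ?ltW// x2; lra.
exists x, 0, z, 0, (4 * x ^+ 2 + 2 * x - 1), 0, (- 2 * x * z).
split; split.
- by rewrite x2 z2; field.
- by rewrite x2 z2; field.
- by rewrite expr0n addr0 gt_eqF// exprn_gt0.
- by rewrite gt_eqF.
- rewrite x2 z2 expr0n addr0.
  have -> : 4 * ((1 + c) / 2) * ((1 - c) / 2) = 1 - c ^+ 2 by field.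
  by rewrite -subr_eq0 addrAC subrr sub0r oppr_eq0 expf_eq0.
- have : k ^+ 2 < x ^+ 2 by rewrite ltr_sqr ?nnegrE// ltW.
  lra.
- have -> : 0 ^+ 2 + (- 2 * x * z) ^+ 2 = 4 * x ^+ 2 * z ^+ 2 by ring.
  by rewrite x2 z2; field.
move=> u n l; rewrite combZ /chord.
have cE : c = 2 * x ^+ 2 - 1 by lra.
have zE : z ^+ 2 = 1 - x ^+ 2 by lra.
by congr comb; rewrite zE ?cE; ring.
Qed.

End Existence.

Unset Implicit Arguments.

(** * The range of attainable angles *)

Theorem proposition5p1 (R : realType) (i : 'rV[R]_3) (p_i p_f : 'rV[R]_3)
    (u_i v_i w_i : 'rV[R]_3)
    (i_unit : enorm i = 1)
    (p_neq : p_i <> p_f)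
    (uvw_orthonormal : orthonormal3 u_i v_i w_i) :
  let Du := (enorm (p_f - p_i))^-1 *: (p_f - p_i) in
  let tau := acos (dot u_i Du) in
  0 < tau < pi ->
  (exists u_f : 'rV[R]_3,
     [/\ enorm u_f = 1, cross u_i u_f <> 0, dot u_i Du = dot Du u_f &
       exists (r : 'rV[{poly R}]_3) (f1 f2 f3 : R -> 'rV[R]_3) (mu : R),
         RRMF5_I i r /\ rational_RMF r f1 f2 f3 /\ 0 < mu /\
         curve_point r 0 = p_i /\ curve_point r 1 = p_f /\
         f1 0 = u_i /\ f2 0 = v_i /\ f3 0 = w_i /\
         velocity r 0 = mu ^+ 2 *: u_i /\ velocity r 1 = mu ^+ 2 *: u_f])
  <-> tau < 4 * pi / 5.
Proof.
move=> Du tau /andP[tau0 taupi].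
have /enorm1P ii := i_unit.
have [[/enorm1P uu _ _] _] := uvw_orthonormal.
have p0 : p_f - p_i != 0.
  by rewrite subr_eq0; apply/eqP => e; apply: p_neq; rewrite e.
have e0 := enorm_gt0 p0.
have dd : dot Du Du = 1.
  by rewrite dotZl dotZr -sqr_enorm; field; rewrite gt_eqF.
have c1 : -1 <= dot u_i Du <= 1.
  rewrite -ler_norml -(ler_sqr (normr_ge0 _) ler01) real_normK ?num_real//.
  by have := dot_cauchy u_i Du; rewrite uu dd mulr1 expr1n.
have cost : cos tau = dot u_i Du by rewrite acosK// in_itv.
have pi0 : 0 < (pi : R) := pi_gt0 R.
have -> : (tau < 4 * pi / 5) = (cos (4 * pi / 5) < dot u_i Du).
  by rewrite -cost ltr_cos// in_itv/=; apply/andP; split; lra.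
split=> [[u_f [/enorm1P ff uf0 bal]]|lt_c].
  move=> [r [_ [_ [_ [mu [rr [_ [mu0 [r0 [r1 [_ [_ [_ [v0 v1]]]]]]]]]]]]]].
  have e : curve_point r 1 - curve_point r 0 = p_f - p_i by rewrite r0 r1.
  have := RRMF5_I_angle_bound ii uu ff mu0 rr v0 v1 uf0; rewrite e; apply=> //.
  have k0 : (enorm (p_f - p_i))^-1 != 0 by rewrite invr_neq0// gt_eqF.
  by apply: (mulfI k0); rewrite -dotZr -dotZl.
have lt_c1 : dot u_i Du < 1.
  by rewrite -cost -(@cos0 R) ltr_cos// in_itv/= ?lexx ?ltW.
have [x [y [z [m [L [e [f [[s1 s2 s3 s4 s5] [L0 ef chE]]]]]]]]] :=
  ex_normal_form_chord lt_c lt_c1.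
have gt_c1 : -1 < dot u_i Du.
  by rewrite -cost -(@cospi R) ltr_cos// in_itv/= ?lexx ?ltW.
have c2 : dot u_i Du ^+ 2 != 1.
  by rewrite sqrf_eq1 negb_or lt_eqF// gt_eqF.
have [n [l [F DuE]]] := ex_rframe_comb uu dd erefl ef c2.
apply: (RRMF5_I_interpolant ii uvw_orthonormal F p0 s1 s2 s3 s4 s5 L0).
by rewrite chE -DuE.
Qed.
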